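(* Let $\mathcal{H}$ be a real Hilbert space and let $f:\mathcal{H}\to\mathbb{R}$ be convex and differentiable with $L$-Lipschitz continuous gradient and $\arg\min_{\mathcal{H}} f\neq\emptyset$. Let $\delta,s,a,b,q,\lambda>0$ satisfy (i) $\frac{1+q}{2+q}\delta<\lambda<\delta$; (ii) $(1+a(1-q))\lambda-a\delta<0$; (iii) $\frac{1-b}{b}\lambda^2+\delta\lambda-1<0$; (iv) $Ls<\frac{q}{q+1}$. Let $c>0$ satisfy $$\frac{1}{\sqrt{sc}}<\min\left\{\frac{2+q}{1+q}\lambda-\delta,\ \frac{1}{1+q}\Big(\delta-\frac{(1+a(1-q))\lambda}{a}\Big),\ \delta-\lambda\right\},$$ and let $\varepsilon_k=\frac{c}{k^2}$ for $k\ge1$. Let $(x_k)_{k\ge0}$ be generated from arbitrary $x_0,x_1\in\mathcal{H}$ by, for $k\ge1$, $$y_k=x_k+(1-\delta\sqrt{s\varepsilon_k})(x_k-x_{k-1}),\qquad x_{k+1}=y_k-s\big(\nabla f(y_k)+\varepsilon_k y_k\big).$$ Then, as $k\to+\infty$, $$f(x_k)-\min_{\mathcal{H}} f=\mathcal{O}\Big(\frac{1}{k^2}\Big),\qquad \|x_k-x_{k-1}\|=\mathcal{O}\Big(\frac1k\Big).$$ *)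

(* Defs.v *)
From HB Require Import structures.
From mathcomp Require Import all_boot all_order all_algebra.
From mathcomp Require Import all_classical all_reals all_analysis.

Set Implicit Arguments.
Unset Strict Implicit.
Unset Printing Implicit Defensive.

Import Order.TTheory GRing.Theory Num.Theory.
Import numFieldNormedType.Exports.

Local Open Scope classical_set_scope.
Local Open Scope ring_scope.

(* Together with the completeness of [H], this makes [H] a real Hilbert space
   with inner product [dot]. *)
Definition norm_induced_by (R : realType) (H : normedModType R)
    (dot : {dot H for (@idfun R)}) : Prop :=
  forall u : H, `|u| = Num.sqrt (dot u u).

(* The Riesz representative of the differential of [f] at [x]. Where [f] is
   differentiable and [H] is a Hilbert space it exists and is unique; [get]
   returns an arbitrary point elsewhere. *)
Definition gradient (R : realType) (H : normedModType R)
    (dot : {dot H for (@idfun R)}) (f : H -> R) (x : H) : H :=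
  get [set g : H | forall h : H, 'd f x h = dot g h].

Definition argmin (R : realType) (T : Type) (f : T -> R) : set T :=
  [set z | forall u : T, f z <= f u].

(* Main.v *)
(* Put theta = sqrt (s c), l = lambda theta, al = delta theta and z a minimizer
   of f. The condition on c forces l > 2 and gam := al - 1 - l > 0, and the
   scheme is Nesterov's with momentum 1 - al / k applied to the function
   f + eps_k |.|^2 / 2, whose quadratic part satisfies
   s eps_k = theta^2 / k^2. With d_k = x_k - x_(k-1), the energy
     E_k = (k - 1)^2 2s (f x_k - f z) + theta^2 |x_k|^2
           + |l (x_k - z) + (k - 1 - l) d_k|^2 + l gam |x_(k-1) - z|^2
   satisfies, for large k,
     E_(k+1) <= E_k - ((l - 2) k + 1) 2s (f x_k - f z)
       - theta^2 (l / k) (|x_k|^2 - |z|^2) - gam (2k - 1 - al) |d_k|^2.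
   The decrease dominates (r / k) E_k - M / k for some r > 0, so E is bounded
   although the perturbation M / k is not summable, and both rates can be
   read off E. *)

Require Import Defs.
From HB Require Import structures.
From mathcomp Require Import all_boot all_order all_algebra.
From mathcomp Require Import all_classical all_reals all_analysis.
From mathcomp Require Import ring lra.

Set Implicit Arguments.
Unset Strict Implicit.
Unset Printing Implicit Defensive.

Import Order.TTheory GRing.Theory Num.Theory.
Import numFieldNormedType.Exports.

Local Open Scope classical_set_scope.
Local Open Scope ring_scope.

(** * Inner product calculus and the Cauchy-Schwarz inequality *)

Section InnerProduct.
Context (R : realType) (H : normedModType R) (dot : {dot H for (@idfun R)}).

Lemma dotC u v : dot u v = dot v u.
Proof. by rewrite hermC /= expr0 mul1r. Qed.

Lemma dotDl u v w : dot (u + v) w = dot u w + dot v w.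
Proof. exact: linearDl. Qed.

Lemma dotDr u v w : dot u (v + w) = dot u v + dot u w.
Proof. exact: linearDr. Qed.

Lemma dot0l u : dot 0 u = 0.
Proof. exact: linear0l. Qed.

Lemma dotNl u v : dot (- u) v = - dot u v.
Proof. exact: linearNl. Qed.

Lemma dotNr u v : dot u (- v) = - dot u v.
Proof. exact: linearNr. Qed.

Lemma dotZl k u v : dot (k *: u) v = k * dot u v.
Proof. exact: linearZl_LR. Qed.

Lemma dotZr k u v : dot u (k *: v) = k * dot u v.
Proof. exact: linearZr_LR. Qed.

Definition dotE := (dotDl, dotDr, dotNl, dotNr, dotZl, dotZr).

Lemma dot_ge0 u : 0 <= dot u u.
Proof.
have [->|u0] := eqVneq u 0; first by rewrite dot0l.
exact/ltW/neq0_dnorm_gt0.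
Qed.

Lemma dotDD_le u v : dot (u + v) (u + v) <= 2 * dot u u + 2 * dot v v.
Proof.
by have := dot_ge0 (u - v); rewrite !dotE (dotC v u); lra.
Qed.

Context (hdot : norm_induced_by dot).

Lemma dot_sqr_norm u : dot u u = `|u| ^+ 2.
Proof. by rewrite hdot sqr_sqrtr// dot_ge0. Qed.

(** Expand the square of [|v| u - |u| v], which is nonnegative, and divide by [|u| |v|]. *)
Lemma dot_le_norm u v : dot u v <= `|u| * `|v|.
Proof.
have [->|u0] := eqVneq u 0.
  by rewrite dot0l mulr_ge0.
have [->|v0] := eqVneq v 0.
  by rewrite dotC dot0l mulr_ge0.
have a0 : 0 < `|u| by rewrite normr_gt0.
have b0 : 0 < `|v| by rewrite normr_gt0.
have := dot_ge0 (`|v| *: u - `|u| *: v).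
rewrite !dotE (dotC v u) !dot_sqr_norm => h.
have ab0 : 0 < `|u| * `|v| by rewrite mulr_gt0.
rewrite -(ler_pM2l ab0); nra.
Qed.

End InnerProduct.

(** * Riesz representation *)

Lemma riesz (R : realType) (H : completeNormedModType R)
    (dot : {dot H for (@idfun R)}) (hdot : norm_induced_by dot)
    (phi : {linear H -> R^o}) :
  continuous phi -> exists g, forall h, phi h = dot g h.
Proof.
move=> phi_cont.
have phiZ k w : phi (k *: w) = k * phi w by rewrite linearZ.
have phiD w w' : phi (w + w') = phi w + phi w' by rewrite linearD.
(* The representative is the minimizer of [J]; minimizing sequences are Cauchy
   by the parallelogram law. *)
pose J u : R := dot u u - 2 * (phi u : R).
have [M /= J_lb] : exists M, forall u, M <= J u.
  have /linear_boundedP := continuous_linear_bounded 0 (phi_cont 0).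
  move=> [r [_ /(_ (r + 1))]]; rewrite ltrDl ltr01 => /(_ isT) phi_le.
  (* With [r + 1] a bound for the norm of [phi], complete the square in
     [|u| ^+ 2 - 2 (r + 1) |u|]. *)
  exists (- (r + 1) ^+ 2) => u; rewrite /J (dot_sqr_norm hdot).
  have := phi_le u; have := ler_norm (phi u).
  have := sqr_ge0 (`|u| - (r + 1)); nra.
have J_inf : has_inf (range J).
  by split; [exists (J 0), 0|exists M => _ [u _ <-]].
set m := inf (range J).
have m_le u : m <= J u by apply: ge_inf; [exact: J_inf.2|exists u].
have /boolp.choice[u_ u_min] n : exists u, J u < m + n.+1%:R^-1.
  have [|_ [u _ <-] Ju] := @inf_adherent R (range J) n.+1%:R^-1 _ J_inf.
    by rewrite invr_gt0.
  by exists u.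
have J_par u v : dot (u - v) (u - v) <= 2 * (J u - m) + 2 * (J v - m).
  have := m_le (2^-1 *: (u + v)).
  rewrite /J phiZ phiD !dotE (dotC dot v u); lra.
have arith (A B p q E D : R) : D <= 2 * (A - m) + 2 * (B - m) ->
    A < m + p -> B < m + q -> p < E / 4 -> q < E / 4 -> D < E by lra.
have u_cvg : cvgn u_.
  apply/cauchy_cvgP/cauchy_ballP => e e0; near_simpl.
  have e2 : 0 < e ^+ 2 / 4 by rewrite divr_gt0// exprn_gt0.
  near=> i j.
  rewrite -ball_normE /=.
  rewrite -(@ltr_pXn2r _ 2)// ?nnegrE// ?(ltW e0)//.
  rewrite -(dot_sqr_norm hdot).
  apply: arith (J_par _ _) (u_min i) (u_min j) _ _.
    by near: i; exact: near_infty_natSinv_lt (PosNum e2).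
  by near: j; exact: near_infty_natSinv_lt (PosNum e2).
set v := limn u_.
have Jv : J v <= m.
  have Ju_cvg : J (u_ n) @[n --> \oo] --> J v.
    apply: cvgB; last first.
      by apply: cvgMl_tmp; exact: (cvg_comp _ _ u_cvg (phi_cont v)).
    rewrite (dot_sqr_norm hdot) (_ : (fun n => _) = (fun n => `|u_ n| ^+ 2)).
      by apply: cvgM; exact: cvg_norm.
    by apply/funext => n; rewrite (dot_sqr_norm hdot).
  have m_cvg : m + n.+1%:R^-1 @[n --> \oo] --> m + 0.
    by apply: cvgD; [exact: cvg_cst|exact: cvg_harmonic].
  rewrite -[leRHS]addr0; apply: ler_cvg_to Ju_cvg m_cvg _.
  by apply: nearW => n; exact/ltW.
exists v => h.
pose d := dot v h - phi h.
have quad t : 0 <= 2 * t * d + t ^+ 2 * dot h h.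
  have := le_trans Jv (m_le (v + t *: h)).
  rewrite /J phiD phiZ !dotE (dotC dot h v) /d; lra.
have c0 : 0 < dot h h + 1 by have := dot_ge0 dot h; lra.
(* The minimizing [t] would be [- d / dot h h]; the [+ 1] also covers [h = 0], and the value stays
   negative unless [d = 0]. *)
have := quad (- d / (dot h h + 1)).
have -> : 2 * (- d / (dot h h + 1)) * d + (- d / (dot h h + 1)) ^+ 2 * dot h h =
  - (d ^+ 2 * ((dot h h + 2) / (dot h h + 1) ^+ 2)).
  by field; rewrite gt_eqF.
rewrite oppr_ge0 pmulr_lle0; last first.
  by rewrite divr_gt0// ?exprn_gt0//; have := dot_ge0 dot h; lra.
move=> d2; have /eqP : d ^+ 2 == 0 by rewrite eq_le d2 sqr_ge0.
by move/eqP; rewrite sqrf_eq0 subr_eq0 => /eqP.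
Unshelve. all: by end_near. Qed.

(** * First-order inequalities for convex functions with Lipschitz gradient *)

Section Gradient.
Context (R : realType) (H : completeNormedModType R).
Context (dot : {dot H for (@idfun R)}) (hdot : norm_induced_by dot).
Context (f : H -> R) (f_diff : forall u, differentiable f u).

(** The differential is continuous, so [riesz] makes the set in [gradient] nonempty and [get]
    returns one of its members. *)
Lemma gradientE x h : 'd f x h = dot (gradient dot f x) h.
Proof.
have [g dfg] := riesz hdot (diff_continuous (f_diff x)).
have : [set g : H | forall h, 'd f x h = dot g h] !=set0 by exists g.
by move=> /getPex; exact.
Qed.

Lemma is_derive_line (u d : H) (t : R) :
  is_derive t (1 : R) (fun r : R => f (u + r *: d) : R^o)
    (dot (gradient dot f (u + t *: d)) d).
Proof.
have line_quot : (fun h : R => h^-1 *: (((fun r : R => f (u + r *: d) : R^o) \o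
      shift t) (h *: (1 : R)) - f (u + t *: d))) =
    (fun h : R => h^-1 *: (((f : H -> R^o) \o shift (u + t *: d)) (h *: d) -
      f (u + t *: d))).
  apply/funext => h /=; congr (_ *: (f _ - _)).
  by rewrite scalerDl addrCA /GRing.scale /= mulr1.
have f_derivable : derivable (f : H -> R^o) (u + t *: d) d.
  exact: diff_derivable.
split; first by rewrite /derivable line_quot.
rewrite -gradientE -(deriveE _ (f_diff _)) /derive line_quot; exact: erefl.
Qed.

(** Convexity bounds the difference quotient from [u] towards [v] by [f v - f u] for [0 < h <= 1];
    let [h] tend to 0 from the right. *)
Lemma convex_gradient_le (f_convex : convex_function [set: H] f) (u v : H) :
  f u + dot (gradient dot f u) (v - u) <= f v.
Proof.
rewrite -lerBrDl -gradientE -deriveE//.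
have quot_cvg : h^-1 *: ((f : H -> R^o) (h *: (v - u) + u) - f u)
    @[h --> (0 : R)^'+] --> 'D_(v - u) (f : H -> R^o) u.
  by apply: cvg_dnbhs_at_right; exact: diff_derivable.
apply: (ler_cvg_to quot_cvg (cvg_cst _)).
near=> h.
have h0 : 0 < h by [].
have h1 : h <= 1 by near: h; exact: nbhs_right_le.
change (h^-1 * (f (h *: (v - u) + u) - f u) <= f v - f u).
have -> : h *: (v - u) + u = h *: v + (1 - h) *: u.
  by rewrite scalerBr scalerBl scale1r addrAC addrA.
rewrite ler_pdivrMl//.
have : f (h *: v + (1 - h) *: u) <= h * f v + (1 - h) * f u :=
  f_convex (Itv01 (ltW h0) h1) v u (mem_setT _) (mem_setT _).
lra.
Unshelve. all: by end_near. Qed.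

Lemma lipschitz_dot_le (L : R) (f_lip : L.-lipschitz (gradient dot f))
    (u d : H) (t : R) : 0 <= t ->
  dot (gradient dot f (u + t *: d)) d <=
  dot (gradient dot f u) d + L * t * dot d d.
Proof.
move=> t0; have /= := f_lip (u + t *: d, u) (conj I I).
rewrite (addrC u) addrK normrZ (ger0_norm t0).
move: (gradient dot f _) (gradient dot f u) => g' g lip.
have := le_trans (dot_le_norm hdot (g' - g) d) (ler_wpM2r (normr_ge0 d) lip).
rewrite dotDl dotNl (dot_sqr_norm hdot) lerBlDl.
by congr (_ <= _ + _); ring.
Qed.

Lemma descent (L : R) (f_lip : L.-lipschitz (gradient dot f)) (u v : H) :
  f v <= f u + dot (gradient dot f u) (v - u) + L / 2 * dot (v - u) (v - u).
Proof.
set d := v - u; set g := gradient dot f.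
(* [psi] is [f] on the segment minus the quadratic majorant without its constant [f u]. Its
   derivative is nonpositive on []0, 1[], so the mean value theorem replaces integration of the
   gradient. *)
pose psi (t : R) : R := f (u + t *: d) -
  (t * dot (g u) d + t ^+ 2 * (L / 2 * dot d d)).
pose dpsi (t : R) : R := dot (g (u + t *: d)) d -
  (dot (g u) d + 2 * t * (L / 2 * dot d d)).
have psi_derive (t : R) : is_derive t (1 : R) (psi : R -> R^o) (dpsi t).
  apply: is_deriveB; first exact: is_derive_line.
  apply: is_derive_eq.
  by rewrite /GRing.scale /=; ring.
have psi_cont : {within `[0, 1], continuous psi}.
  by apply: derivable_within_continuous => t _; have [] := psi_derive t.
have [t t01 psi_t] := MVT ltr01 (fun t _ => psi_derive t) psi_cont.
have : psi 1 <= psi 0.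
  rewrite -subr_le0 psi_t subr0 mulr1 /dpsi.
  have t0 : 0 < t by move: t01; rewrite in_itv => /andP[].
  rewrite subr_le0 [2 * t * _](_ : _ = L * t * dot d d); last by field.
  exact: lipschitz_dot_le (ltW t0).
rewrite /psi scale0r addr0 scale1r [u + d]addrC subrK; lra.
Qed.

End Gradient.

(** * One step of the scheme and the Lyapunov energy *)

Section Energy.
Context (R : realType) (H : completeNormedModType R).
Context (dot : {dot H for (@idfun R)}) (hdot : norm_induced_by dot).
Context (f : H -> R).

(** A gradient step for [f + e |.|^2 / 2], with gradient [G] at [y]: add the convexity inequality
    from [y] to [u] to the descent inequality from [y] to [xn]. *)
Lemma tikhonov_step_le (L s e : R) (y xn u : H) :
  convex_function [set: H] f -> (forall v, differentiable f v) ->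
  L.-lipschitz (gradient dot f) -> 0 < s -> 0 <= e -> s * (L + e) <= 1 ->
  xn = y - s *: (gradient dot f y + e *: y) ->
  2 * s * (f xn - f u) + s * e * (dot xn xn - dot u u) <=
  dot (y - u) (y - u) - dot (xn - u) (xn - u).
Proof.
move=> f_convex f_diff f_lip s0 e0 sLe xnE.
have convex_y := convex_gradient_le hdot f_diff f_convex y u.
have descent_y := descent hdot f_diff f_lip y xn.
set g := gradient dot f y in convex_y descent_y xnE.
set G := g + e *: y in xnE.
have gE : g = G - e *: y by rewrite /G addrK.
have stepE : xn - y = - (s *: G) by rewrite xnE addrAC subrr add0r.
(* The two terms given up: the step size slack, and the strong convexity of the quadratic part. *)
have gap1 : 0 <= s ^+ 2 * dot G G * (1 - s * (L + e)).
  by apply: mulr_ge0; rewrite ?subr_ge0// mulr_ge0 ?sqr_ge0 ?dot_ge0.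
have gap2 : 0 <= s * e * dot (y - u) (y - u).
  by rewrite !mulr_ge0 ?dot_ge0 ?(ltW s0).
have := ler_wpM2l (ltW s0) (lerD convex_y descent_y).
move: gap1 gap2; clearbody G g; rewrite stepE xnE gE !dotE.
rewrite (dotC dot u y) (dotC dot y G) (dotC dot u G).
move: (f _) (f _) (f _) (dot G G) => f1 f2 f3 GG.
lra.
Qed.

(* Here [k] is the real value of the index and [xp], [x0] stand for
   [x (k - 1)], [x k]; the first weight is [(k - 1)^2] so that, at index
   [k + 1], it is the factor [k^2] which turns [s * eps k] into [T = s * c]. *)
Definition tikhonov_energy (s T l gam : R) (z : H) (k : R) (xp x0 : H) : R :=
  (k - 1) ^+ 2 * (2 * s * (f x0 - f z)) + T * dot x0 x0 +
  dot (l *: (x0 - z) + (k - 1 - l) *: (x0 - xp))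
      (l *: (x0 - z) + (k - 1 - l) *: (x0 - xp)) +
  l * gam * dot (xp - z) (xp - z).

Lemma tikhonov_energy_step (s T l al gam k : R) (xp x0 xn z : H) :
  k != 0 -> 0 < l <= k -> gam = al - 1 - l ->
  let y := x0 + (1 - al / k) *: (x0 - xp) in
  (forall u, 2 * s * (f xn - f u) + T / k ^+ 2 * (dot xn xn - dot u u) <=
     dot (y - u) (y - u) - dot (xn - u) (xn - u)) ->
  tikhonov_energy s T l gam z (k + 1) x0 xn <=
  tikhonov_energy s T l gam z k xp x0 -
  (((l - 2) * k + 1) * (2 * s * (f x0 - f z)) +
   T * (l / k) * (dot x0 x0 - dot z z) +
   gam * (2 * k - 1 - al) * dot (x0 - xp) (x0 - xp)).
Proof.
move=> k0 /andP[l0 lk] -> y step.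
(* Nesterov's combination: the step inequality at [u = x0] with weight
   [k (k - l)] plus the one at [u = z] with weight [k l]. *)
have kl : 0 <= k * (k - l).
  by rewrite mulr_ge0// ?subr_ge0// (le_trans (ltW l0)).
have kl' : 0 <= k * l by rewrite mulr_ge0 ?(ltW l0)// (le_trans (ltW l0)).
have := lerD (ler_wpM2l kl (step x0)) (ler_wpM2l kl' (step z)).
rewrite /tikhonov_energy.
have -> : xn - z = (xn - x0) + (x0 - z) by rewrite addrA subrK.
have -> : xp - z = (x0 - z) - (x0 - xp) by rewrite opprB [RHS]addrC addrA subrK.
have -> : y - x0 = (1 - al / k) *: (x0 - xp) by rewrite /y addrAC subrr add0r.
have -> : y - z = (x0 - z) + (1 - al / k) *: (x0 - xp) by rewrite /y addrAC.
move: (xn - x0) (x0 - xp) (x0 - z) => p d h.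
move: (dot xn xn) (dot x0 x0) (dot z z) (f xn) (f x0) (f z)
  => qn q0 qz fn f0 fz.
rewrite !dotE (dotC dot d h) (dotC dot p h).
move: (dot h h) (dot d d) (dot p p) (dot h d) (dot h p) => hh dd pp hd hp.
rewrite -subr_ge0 => step_z; rewrite -subr_ge0; apply: le_trans step_z _.
(* Nothing is lost here: the slack of the combined inequality equals the slack of the goal. *)
by rewrite le_eqVlt; apply/orP; left; apply/eqP; field.
Qed.

(** Expresses the energy through the quantities that occur in its decrease. Distances to [z] are
    traded for norms by [dotDD_le], since the Tikhonov term controls [dot x0 x0]. *)
Lemma tikhonov_energy_le (s T l gam : R) (z : H) (k : R) (xp x0 : H) :
  0 <= s -> 0 <= l -> 0 <= gam -> 1 + l <= k -> f z <= f x0 ->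
  tikhonov_energy s T l gam z k xp x0 <=
  k ^+ 2 * (2 * s * (f x0 - f z)) +
  (T + 4 * l ^+ 2 + 4 * l * gam) * dot x0 x0 +
  (2 + 2 * l * gam) * (k ^+ 2 * dot (x0 - xp) (x0 - xp)) +
  (4 * l ^+ 2 + 4 * l * gam) * dot z z.
Proof.
move=> s0 l0 gam0 lk fz; rewrite /tikhonov_energy.
have W0 : 0 <= 2 * s * (f x0 - f z) by rewrite !mulr_ge0// subr_ge0.
have -> : xp - z = (x0 - z) - (x0 - xp) by rewrite opprB [RHS]addrC addrA subrK.
move: (x0 - xp) => d.
have h_le : dot (x0 - z) (x0 - z) <= 2 * dot x0 x0 + 2 * dot z z.
  by have := dotDD_le dot x0 (- z); rewrite dotNl dotNr opprK.
move: (x0 - z) h_le => h h_le.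
have V_le : dot (l *: h + (k - 1 - l) *: d) (l *: h + (k - 1 - l) *: d) <=
    2 * (l ^+ 2 * dot h h) + 2 * ((k - 1 - l) ^+ 2 * dot d d).
  by have := dotDD_le dot (l *: h) ((k - 1 - l) *: d);
    rewrite !dotZl !dotZr !mulrA.
have p_le : dot (h - d) (h - d) <= 2 * dot h h + 2 * dot d d.
  by have := dotDD_le dot h (- d); rewrite dotNl dotNr opprK.
have lg0 : 0 <= l * gam by rewrite mulr_ge0.
have k1_le : (k - 1) ^+ 2 <= k ^+ 2 by rewrite lerXn2r ?nnegrE; lra.
have kl_le : (k - 1 - l) ^+ 2 <= k ^+ 2 by rewrite lerXn2r ?nnegrE; lra.
have k_ge1 : 1 <= k ^+ 2 by rewrite exprn_ege1; lra.
have {}k1_le := ler_wpM2r W0 k1_le.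
have {}kl_le := ler_wpM2r (dot_ge0 dot d) kl_le.
have {}k_ge1 := ler_wpM2r (dot_ge0 dot d) k_ge1.
have {}p_le := ler_wpM2l lg0 p_le.
have lh_le := ler_wpM2l (sqr_ge0 l) h_le.
have lgh_le := ler_wpM2l lg0 h_le.
have {}k_ge1 := ler_wpM2l lg0 k_ge1.
move: (dot (_ + _) (_ + _)) (dot (h - d) _) (dot h h) (dot d d) (dot x0 x0)
  (dot z z) (f x0 - f z) V_le p_le h_le k1_le kl_le k_ge1 lh_le lgh_le
  => V P hh dd A Z F.
clear; lra.
Qed.

(** The three conditions on [r] say that the decrease, multiplied by [k], dominates [r] times the
    bound of [tikhonov_energy_le] term by term; the multiples of [dot z z] remain as the
    perturbation. *)
Lemma tikhonov_energy_decrease (s T l al gam r : R) (z : H) (k : R)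
    (xp x0 xn : H) :
  0 <= s -> 0 <= l -> 0 <= gam -> 1 + l <= k -> 1 + al <= k -> f z <= f x0 ->
  0 <= r -> r <= l - 2 -> r * (T + 4 * l ^+ 2 + 4 * l * gam) <= T * l ->
  r * (2 + 2 * l * gam) <= gam ->
  tikhonov_energy s T l gam z (k + 1) x0 xn <=
  tikhonov_energy s T l gam z k xp x0 -
  (((l - 2) * k + 1) * (2 * s * (f x0 - f z)) +
   T * (l / k) * (dot x0 x0 - dot z z) +
   gam * (2 * k - 1 - al) * dot (x0 - xp) (x0 - xp)) ->
  tikhonov_energy s T l gam z (k + 1) x0 xn <=
  (1 - r / k) * tikhonov_energy s T l gam z k xp x0 +
  (T * l + r * (4 * l ^+ 2 + 4 * l * gam)) * dot z z / k.
Proof.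
move=> s0 l0 gam0 lk alk fz r0 rl rT rgam /le_trans; apply.
have k0 : 0 < k by lra.
have E_le := ler_wpM2l r0 (tikhonov_energy_le T xp s0 l0 gam0 lk fz).
have W0 : 0 <= 2 * s * (f x0 - f z) by rewrite !mulr_ge0// subr_ge0.
move: (tikhonov_energy _ _ _ _ _ _ _ _) (2 * s * _) W0 E_le => E W W0 E_le.
have A0 := dot_ge0 dot x0; have D0 := dot_ge0 dot (x0 - xp).
move: (dot x0 x0) (dot (x0 - xp) _) (dot z z) A0 D0 E_le => A D Z A0 D0 E_le.
set M := (T * l + _) * Z.
suff X_ge : r * E - M <= k * (((l - 2) * k + 1) * W + T * (l / k) * (A - Z) +
    gam * (2 * k - 1 - al) * D).
  rewrite -ler_pdivrMl// in X_ge.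
  have -> : (1 - r / k) * E + M / k = E - k^-1 * (r * E - M) by ring.
  by rewrite lerD2l lerN2.
have -> : k * (((l - 2) * k + 1) * W + T * (l / k) * (A - Z) +
    gam * (2 * k - 1 - al) * D) = (l - 2) * (k ^+ 2 * W) + k * W +
    T * l * (A - Z) + gam * (k * (2 * k - 1 - al) * D).
  by field; rewrite gt_eqF.
have kW0 : 0 <= k * W by rewrite mulr_ge0// ltW.
have k2D0 : 0 <= k ^+ 2 * D by rewrite mulr_ge0// sqr_ge0.
have rW := ler_wpM2r (mulr_ge0 (sqr_ge0 k) W0) rl.
have rA := ler_wpM2r A0 rT.
have rD := ler_wpM2r k2D0 rgam.
(* [1 + al <= k] gives [k <= 2 * k - 1 - al]. *)
have D_le : k ^+ 2 * D <= k * (2 * k - 1 - al) * D.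
  by rewrite ler_wpM2r// expr2 ler_wpM2l ?(ltW k0)//; lra.
have {}D_le := ler_wpM2l gam0 D_le.
rewrite /M; move: E_le kW0 rW rA rD D_le; clear; lra.
Qed.

(** All terms of the energy are nonnegative. The velocity is recovered by subtracting
    [l *: (x0 - z)] from [V], and [x0] is bounded by the Tikhonov term. Since [k - 1] and
    [k - 1 - l] are at least [k / 2], passing to [k ^+ 2] costs a factor 4. *)
Lemma tikhonov_energy_rate (s T l gam B : R) (z : H) (k : R) (xp x0 : H) :
  0 < s -> 0 < T -> 0 <= l -> 0 <= gam -> 2 * (1 + l) <= k -> f z <= f x0 ->
  tikhonov_energy s T l gam z k xp x0 <= B ->
  k ^+ 2 * (f x0 - f z) <= 2 * B / s /\
  k ^+ 2 * dot (x0 - xp) (x0 - xp) <=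
    8 * B + 16 * l ^+ 2 * (B / T + dot z z).
Proof.
move=> s0 T0 l0 gam0 lk fz; rewrite /tikhonov_energy.
set V := (_ *: _ + _); set W := (2 * s * _) => E_le.
have W0 : 0 <= W by rewrite !mulr_ge0 ?subr_ge0// ltW.
have P0 : 0 <= l * gam * dot (xp - z) (xp - z) by rewrite !mulr_ge0 ?dot_ge0.
have V0 := dot_ge0 dot V.
have A0 : 0 <= T * dot x0 x0 by rewrite mulr_ge0 ?dot_ge0 ?(ltW T0).
have kW0 : 0 <= (k - 1) ^+ 2 * W by rewrite mulr_ge0// sqr_ge0.
have half_sqr (m : R) : k / 2 <= m -> k ^+ 2 <= 4 * m ^+ 2.
  move=> km; have : (k / 2) ^+ 2 <= m ^+ 2 by rewrite lerXn2r ?nnegrE; lra.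
  by rewrite expr_div_n ler_pdivrMr ?exprn_gt0// => k2_le; lra.
split.
  have k1 : k ^+ 2 <= 4 * (k - 1) ^+ 2 by apply: half_sqr; lra.
  have := ler_wpM2r W0 k1; rewrite ler_pdivlMr//.
  have -> : k ^+ 2 * (f x0 - f z) * s = k ^+ 2 * W / 2 by rewrite /W; field.
  move: E_le P0 V0 A0; clear; lra.
have mdE : (k - 1 - l) *: (x0 - xp) = V + - (l *: (x0 - z)).
  by rewrite /V (addrC (l *: _)) addrK.
have md_le := dotDD_le dot V (- (l *: (x0 - z))).
rewrite -mdE dotNl dotNr opprK !dotZl !dotZr !mulrA -!expr2 in md_le.
have h_le : dot (x0 - z) (x0 - z) <= 2 * dot x0 x0 + 2 * dot z z.
  by have := dotDD_le dot x0 (- z); rewrite dotNl dotNr opprK.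
have A_le : dot x0 x0 <= B / T by rewrite ler_pdivlMr//; lra.
have m_le : k ^+ 2 <= 4 * (k - 1 - l) ^+ 2 by apply: half_sqr; lra.
have {}m_le := ler_wpM2r (dot_ge0 dot (x0 - xp)) m_le.
have {}h_le := ler_wpM2l (sqr_ge0 l) h_le.
have {}A_le := ler_wpM2l (sqr_ge0 l) A_le.
move: E_le P0 V0 A0 kW0 md_le m_le h_le A_le; clear; lra.
Qed.

End Energy.

(** * Scalar recursion and choice of parameters *)

(** For [k >= r] the right side of the recursion is a convex combination of [e k] and [M / r], both
    at most [B]. *)
Lemma relaxation_bounded (R : realFieldType) (e : nat -> R) (r M B : R)
    (K : nat) :
  (0 < K)%N -> 0 < r <= K%:R -> M <= r * B -> e K <= B ->
  (forall k, (K <= k)%N -> e k.+1 <= (1 - r / k%:R) * e k + M / k%:R) ->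
  forall k, (K <= k)%N -> e k <= B.
Proof.
move=> K0 /andP[r0 rK] MB eK e_step; elim=> [|k IHk].
  by rewrite leqn0 => /eqP <-.
rewrite leq_eqVlt => /predU1P[<-//|]; rewrite ltnS => Kk.
have k0 : 0 < k%:R :> R by rewrite ltr0n (leq_trans K0).
have rk : 0 <= 1 - r / k%:R.
  by rewrite subr_ge0 ler_pdivrMr// mul1r (le_trans rK)// ler_nat.
apply: le_trans (e_step k Kk) _.
have := ler_wpM2l rk (IHk Kk).
have : M / k%:R <= r / k%:R * B by rewrite mulrAC ler_pM2r ?invr_gt0.
lra.
Qed.

(** Multiply both bounds by [theta]. The second is the second conclusion; adding [1 + q] times it to
    [1 + q] times the first cancels [delta] and leaves [lambda * theta > 2 (1 + q)]. *)
Lemma tikhonov_parameters (R : realFieldType) (q delta lambda theta : R) :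
  0 < q -> 0 < theta ->
  1 / theta < (2 + q) / (1 + q) * lambda - delta ->
  1 / theta < delta - lambda ->
  2 < lambda * theta /\ 1 + lambda * theta < delta * theta.
Proof.
move=> q0 th0; rewrite !ltr_pdivrMr// => h1 h2.
have q1 : 0 < 1 + q by lra.
rewrite -(ltr_pM2l q1) in h1.
have E : (1 + q) * (((2 + q) / (1 + q) * lambda - delta) * theta) =
    (2 + q) * (lambda * theta) - (1 + q) * (delta * theta).
  by field; rewrite gt_eqF.
rewrite {}E mulr1 in h1; rewrite mulrBl in h2.
have h3 : (1 + q) * 1 < (1 + q) * (delta * theta - lambda * theta).
  by rewrite ltr_pM2l.
split; lra.
Qed.

Lemma exists_rate (R : realFieldType) (T l gam : R) :
  0 < T -> 2 < l -> 0 < gam ->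
  exists r, [/\ 0 < r, r <= l - 2,
    r * (T + 4 * l ^+ 2 + 4 * l * gam) <= T * l &
    r * (2 + 2 * l * gam) <= gam].
Proof.
move=> T0 l2 gam0; have l0 : 0 < l by lra.
have lg0 : 0 < l * gam by rewrite mulr_gt0.
have ll0 : 0 < l ^+ 2 by rewrite exprn_gt0.
have c1 : 0 < T + 4 * l ^+ 2 + 4 * l * gam by lra.
have c2 : 0 < 2 + 2 * l * gam by lra.
exists (Num.min (l - 2) (Num.min (T * l / (T + 4 * l ^+ 2 + 4 * l * gam))
  (gam / (2 + 2 * l * gam)))).
split.
- by rewrite !lt_min subr_gt0 l2 !divr_gt0// mulr_gt0.
- by rewrite ge_min lexx.
- by rewrite -ler_pdivlMr// !ge_min lexx orbT.
- by rewrite -ler_pdivlMr// !ge_min lexx !orbT.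
Qed.

Lemma inf_range_argmin (R : realType) (T : Type) (f : T -> R) (z : T) :
  argmin f z -> inf (range f) = f z.
Proof.
move=> fz; apply/eqP; rewrite eq_le; apply/andP; split.
  by apply: ge_inf; [exists (f z) => _ [u _ <-]|exists z].
by apply: lb_le_inf; [exists (f z), z|move=> _ [u _ <-]].
Qed.

(** * Thresholds, boundedness of the energy and the rates *)

Theorem theorem3p3 (R : realType) (H : completeNormedModType R)
    (dot : {dot H for (@idfun R)}) (hdot : norm_induced_by dot)
    (f : H -> R) (L : R)
    (f_convex : convex_function [set: H] f)
    (f_diff : forall u : H, differentiable f u)
    (f_grad_lip : L.-lipschitz (gradient dot f))
    (f_argmin : argmin f !=set0)
    (delta s a b q lambda : R)
    (delta_gt0 : 0 < delta) (s_gt0 : 0 < s) (a_gt0 : 0 < a) (b_gt0 : 0 < b)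
    (q_gt0 : 0 < q) (lambda_gt0 : 0 < lambda)
    (h1 : (1 + q) / (2 + q) * delta < lambda < delta)
    (h2 : (1 + a * (1 - q)) * lambda - a * delta < 0)
    (h3 : (1 - b) / b * lambda ^+ 2 + delta * lambda - 1 < 0)
    (h4 : L * s < q / (q + 1))
    (c : R) (c_gt0 : 0 < c)
    (hc : 1 / Num.sqrt (s * c) <
          Num.min ((2 + q) / (1 + q) * lambda - delta)
            (Num.min
               (1 / (1 + q) * (delta - (1 + a * (1 - q)) * lambda / a))
               (delta - lambda)))
    (eps : nat -> R)
    (heps : forall k : nat, (1 <= k)%N -> eps k = c / k%:R ^+ 2)
    (x y : nat -> H)
    (hy : forall k : nat, (1 <= k)%N ->
       y k = x k + (1 - delta * Num.sqrt (s * eps k)) *: (x k - x k.-1))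
    (hx : forall k : nat, (1 <= k)%N ->
       x k.+1 = y k - s *: (gradient dot f (y k) + eps k *: y k)) :
  (fun k : nat => (f (x k) - inf (range f) : R^o)) =O_\oo
    (fun k : nat => (1 / k%:R ^+ 2 : R^o))
  /\
  (fun k : nat => (`|x k - x k.-1| : R^o)) =O_\oo
    (fun k : nat => (1 / k%:R : R^o)).
Proof.
case: f_argmin => z fz; rewrite (inf_range_argmin fz).
pose theta := Num.sqrt (s * c); pose T := s * c.
have T0 : 0 < T by rewrite mulr_gt0.
have theta0 : 0 < theta by rewrite sqrtr_gt0.
have thetaE : theta ^+ 2 = T by rewrite sqr_sqrtr// ltW.
pose l := lambda * theta; pose al := delta * theta.
have [l2 al1] : 2 < l /\ 1 + l < al.
  move: hc; rewrite !lt_min => /and3P[? _ ?].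
  exact: tikhonov_parameters q_gt0 theta0 _ _.
pose gam := al - 1 - l.
have l0 : 0 <= l by lra.
have gam0 : 0 < gam by rewrite /gam; lra.
have [r [r0 r_l r_T r_gam]] := exists_rate T0 l2 gam0.
have Ls0 : 0 < 1 - L * s.
  rewrite subr_gt0 (lt_trans h4)// ltr_pdivrMr; lra.
(* A sum of nonnegative thresholds, so [k >= N] exceeds each: for reading the rates, for the
   decrease, for [0 <= 1 - r / k], and for [s * (L + eps k) <= 1], where [k <= k ^+ 2] is used. *)
pose N := 2 * (1 + l) + (1 + al) + r + T / (1 - L * s).
have TL0 : 0 < T / (1 - L * s) by rewrite divr_gt0.
have N0 : 0 <= N by rewrite /N; lra.
pose K := Num.bound N.
have K_large k : (K <= k)%N -> N <= k%:R.
  by rewrite -(ler_nat R); apply/le_trans/ltW/archi_boundP.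
have K0 : (0 < K)%N by rewrite -(ltr0n R) (le_lt_trans N0)// archi_boundP.
pose E k := tikhonov_energy dot f s T l gam z k%:R (x k.-1) (x k).
pose M := (T * l + r * (4 * l ^+ 2 + 4 * l * gam)) * dot z z.
have E_step k : (K <= k)%N -> E k.+1 <= (1 - r / k%:R) * E k + M / k%:R.
  move=> Kk; have k_large := K_large k Kk; rewrite /N in k_large.
  have k_gt0 : (0 < k)%N := leq_trans K0 Kk.
  have k0 : 0 < k%:R :> R by rewrite ltr0n.
  rewrite /E -(natr1 k) /=.
  have seps : s * eps k = T / k%:R ^+ 2 by rewrite heps// mulrA.
  have sqrt_seps : Num.sqrt (s * eps k) = theta / k%:R.
    rewrite seps -thetaE -expr_div_n sqrtr_sqr ger0_norm// divr_ge0 ?ltW//.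
  have yE : y k = x k + (1 - al / k%:R) *: (x k - x k.-1).
    by rewrite hy// sqrt_seps mulrA.
  have eps0 : 0 <= eps k by rewrite heps// divr_ge0 ?exprn_ge0 ?ltW.
  have sLeps : s * (L + eps k) <= 1.
    rewrite mulrDr seps -lerBrDl (mulrC s) ler_pdivrMr ?exprn_gt0//.
    rewrite -ler_pdivrMl// (mulrC _ T).
    apply: le_trans (_ : k%:R <= _); first by lra.
    by rewrite expr2 ler_peMl ?(ltW k0)// ler1n.
  have step u := tikhonov_step_le hdot u f_convex f_diff f_grad_lip s_gt0 eps0
    sLeps (hx k k_gt0).
  rewrite seps yE in step.
  have l_k : 0 < l <= k%:R by apply/andP; split; lra.
  have := tikhonov_energy_step z (lt0r_neq0 k0) l_k (erefl gam) step.
  apply: tikhonov_energy_decrease (ltW s_gt0) l0 (ltW gam0) _ _ (fz _)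
    (ltW r0) r_l r_T r_gam; lra.
(* [M / r] is the level that the recursion leaves fixed. *)
pose B := Num.max (E K) (M / r).
have E_le k : (K <= k)%N -> E k <= B.
  apply: (relaxation_bounded K0 _ _ _ E_step).
  - rewrite r0 /=; have := K_large K (leqnn K); rewrite /N; lra.
  - by rewrite mulrC -ler_pdivrMr// le_max lexx orbT.
  - by rewrite le_max lexx.
have rate k : (K <= k)%N -> [/\ 0 < k%:R :> R,
    k%:R ^+ 2 * (f (x k) - f z) <= 2 * B / s &
    k%:R ^+ 2 * dot (x k - x k.-1) (x k - x k.-1) <=
      8 * B + 16 * l ^+ 2 * (B / T + dot z z)].
  move=> Kk; have k_large := K_large k Kk; rewrite /N in k_large.
  have k2 : 2 * (1 + l) <= k%:R by lra.
  have [F_le D_le] :=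
    tikhonov_energy_rate s_gt0 T0 l0 (ltW gam0) k2 (fz _) (E_le k Kk).
  by split=> //; lra.
split; apply/eqO_exP.
  (* The [+ 1] provides the strictly positive constant that [eqO_exP] asks for. *)
  exists (`|2 * B / s| + 1); first by rewrite ltr_wpDl.
  exists K => // k /= /rate[k0 F_le _].
  have k2 : 0 < k%:R ^+ 2 :> R by rewrite exprn_gt0.
  rewrite ger0_norm ?subr_ge0 ?fz// (ger0_norm (divr_ge0 ler01 (ltW k2))).
  rewrite mulrA mulr1 ler_pdivlMr ?exprn_gt0// mulrC (le_trans F_le)//.
  by rewrite (le_trans (ler_norm _))// lerDl.
set Q := 8 * B + _ in rate.
exists (Num.sqrt Q + 1); first by rewrite ltr_wpDl// sqrtr_ge0.
exists K => // k /= /rate[k0 _ D_le].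
rewrite normr_id (ger0_norm (divr_ge0 ler01 (ltW k0))).
rewrite mulrA mulr1 ler_pdivlMr// mulrC -(ger0_norm (ltW k0)).
rewrite (dot_sqr_norm hdot) -exprMn in D_le.
rewrite (ger0_norm (ltW k0)) (le_trans _ (_ : Num.sqrt Q <= _)) ?lerDl//.
by rewrite -(ger0_norm (mulr_ge0 (ltW k0) (normr_ge0 _))) -sqrtr_sqr ler_wsqrtr.
Qed.
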